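(* Let $\mathbb{F}$ be an infinite field endowed with a nontrivial non-archimedean absolute value $|\cdot|$, and equip $\mathbb{F}$ with the metric $d(x,y)=|x-y|$. Then $\mathrm{md}(\mathbb{F})=\mathrm{dens}(\mathbb{F})$. Moreover, the same equality holds if the infinite field $\mathbb{F}$ is instead endowed with the trivial absolute value, in which case $\mathrm{md}(\mathbb{F})=\mathrm{dens}(\mathbb{F})=\mathrm{card}(\mathbb{F})$.
   Context: An absolute value on a field $\mathbb{F}$ is a function $|\cdot|:\mathbb{F}\to[0,\infty)$ with (i) $|x|=0$ if and only if $x=0$; (ii) $|xy|=|x||y|$ for all $x,y$; (iii) $|x+y|\le|x|+|y|$ for all $x,y$. It is non-archimedean if $|x+y|\le\max(|x|,|y|)$ for all $x,y$. It is trivial if $|0|=0$ and $|x|=1$ for all $x\ne0$, and nontrivial otherwise. For a metric space $(X,d)$, a subset $A\subseteq X$ is resolving if the map $x\mapsto(d(x,a))_{a\in A}$ from $X$ to $\mathbb{R}^A$ is injective, i.e. if $d(x,a)=d(y,a)$ for all $a\in A$ implies $x=y$. The metric dimension $\mathrm{md}(X)$ is the smallest cardinality of a resolving set for $X$. The density character $\mathrm{dens}(X)$ of a topological space $X$ is the smallest cardinality of a dense subset of $X$; here $\mathbb{F}$ carries the topology induced by $d$. $\mathrm{card}(\mathbb{F})$ is the cardinality of $\mathbb{F}$. *)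

(* Defs.v *)
From HB Require Import structures.
From mathcomp Require Import all_boot all_order all_algebra.
From mathcomp Require Import boolp classical_sets functions cardinality reals.
From mathcomp Require Import topology.
Set Implicit Arguments.
Unset Strict Implicit.
Unset Printing Implicit Defensive.
Import Order.TTheory GRing.Theory Num.Theory.
Local Open Scope classical_set_scope.
Local Open Scope card_scope.
Local Open Scope ring_scope.

Record absolute_value (R : realType) (F : fieldType) := AbsoluteValue {
  absval :> F -> R;
  absval_ge0 : forall x, 0 <= absval x;
  absval_eq0 : forall x, absval x = 0 <-> x = 0;
  absvalM : forall x y, absval (x * y) = absval x * absval y;
  absvalD : forall x y, absval (x + y) <= absval x + absval y }.

Definition nonarchimedean (R : realType) (F : fieldType)
    (v : absolute_value R F) :=
  forall x y, v (x + y) <= Num.max (v x) (v y).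

Definition trivial_absval (R : realType) (F : fieldType)
    (v : absolute_value R F) :=
  v 0 = 0 /\ forall x, x <> 0 -> v x = 1.

(* F as a metric space for d(x, y) = v (x - y); the alias carries v so that
   the metric can be found by instance inference. *)
Definition valued (R : realType) (F : fieldType) (v : absolute_value R F)
  : Type := F.

Section valued_metric.
Variables (R : realType) (F : fieldType) (v : absolute_value R F).

Definition absval_dist (x y : valued v) : R := v ((x : F) - (y : F)).

Fact absval_distxx x : absval_dist x x = 0.
Proof. by rewrite /absval_dist subrr; apply/absval_eq0. Qed.

Fact absval_dist_positivity x y : absval_dist x y = 0 -> x = y.
Proof. by move/absval_eq0/eqP; rewrite subr_eq0 => /eqP. Qed.

Fact absval_dist_sym x y : absval_dist x y = absval_dist y x.
Proof.
have v1 : v 1 = 1.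
  have v1N0 : v 1 != 0 by apply/eqP => /absval_eq0/eqP; rewrite oner_eq0.
  by apply: (mulfI v1N0); rewrite -absvalM !mulr1.
have vN1 : v (-1) = 1.
  apply/eqP; rewrite -(@eqrXn2 _ 2) ?absval_ge0 //.
  by rewrite expr1n expr2 -absvalM mulrNN mulr1 v1.
by rewrite /absval_dist -opprB -mulN1r absvalM vN1 mul1r.
Qed.

Fact absval_dist_triangle y x z :
  absval_dist x z <= absval_dist x y + absval_dist y z.
Proof. by rewrite /absval_dist -(subrKA (y : F)); exact: absvalD. Qed.

HB.instance Definition _ := Choice.copy (valued v) F.
HB.instance Definition _ := @isMetric.Build R (valued v) absval_dist
  absval_distxx absval_dist_positivity absval_dist_sym absval_dist_triangle.

Lemma mdist_valuedE (x y : valued v) : mdist x y = v ((x : F) - (y : F)).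
Proof. by []. Qed.

End valued_metric.

Definition resolving (R : realType) (X : metricType R) (A : set X) :=
  forall x y : X, (forall a, A a -> mdist x a = mdist y a) -> x = y.

(* A cardinal is represented by a set K, up to equipotence #= :
   the smallest cardinality of a set satisfying P is the cardinality of K. *)
Definition smallest_card (T U : Type) (P : set T -> Prop) (K : set U) :=
  (exists2 A, P A & A #= K) /\ forall A, P A -> K #<= A.

(* md(X) = card(K) *)
Definition metric_dimension (R : realType) (X : metricType R) (U : Type)
    (K : set U) :=
  smallest_card (@resolving R X) K.

(* dens(X) = card(K) *)
Definition density_character (X : topologicalType) (U : Type) (K : set U) :=
  smallest_card (@dense X) K.

(* Main.v *)
Require Import Defs.
From mathcomp Require Import all_boot all_order all_algebra.
From mathcomp Require Import boolp classical_sets functions cardinality reals.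
From mathcomp Require Import topology normedtype sequences.
Import Order.TTheory GRing.Theory Num.Theory.
Import numFieldNormedType.Exports.
Local Open Scope classical_set_scope.

(* In an ultrametric space, d(x, a) <> d(y, a) forces d(x, a) <= d(x, y), so a
   resolving set meets the closed ball of radius d(x, y) around x whenever
   y <> x.  A nontrivial absolute value provides such y arbitrarily close to x:
   every resolving set is then dense, and the converse holds in all metric
   spaces.  For the trivial absolute value, a resolving set omits at most one
   point and the only dense set is the whole field. *)

Lemma ex_card_min (T : Type) (P : set (set T)) : P !=set0 ->
  exists2 A, P A & forall B, P B -> (A #<= B)%card.
Proof.
move=> [A0 PA0].
(* A maximal family S of choice functions on P with pairwise disjoint graphs
   projects onto some A in P, since otherwise it could be extended;
   all the projections are injective, so this A embeds in every B in P. *)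
pose disjoint_choices (S : set (set T -> T)) :=
  (forall f A, S f -> P A -> A (f A)) /\
  (forall f g A, S f -> S g -> P A -> f A = g A -> f = g).
have [Fs sFs totFs|S [[S_choice S_inj] S_max]] :=
    @Zorn_bigcup _ disjoint_choices.
  split=> [f A [X FsX Xf]|f g A [X FsX Xf] [Y FsY Yg]].
    by have [+ _] := sFs _ FsX; apply.
  have [XY|YX] := totFs _ _ FsX FsY.
    by have [_ +] := sFs _ FsY; apply=> //; exact: XY.
  by have [_ +] := sFs _ FsX; apply=> //; exact: YX.
have [[A PA SA]|noA] :=
    pselect (exists2 A, P A & A `<=` (fun f : set T -> T => f A) @` S).
  exists A => // B PB; apply: (card_le_trans (subset_card_le SA)).
  have injS C : P C -> {in S &, injective (fun f : set T -> T => f C)}.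
    by move=> PC f g /set_mem Sf /set_mem Sg; exact: S_inj.
  have := inj_card_eq (injS _ PA); have := inj_card_eq (injS _ PB).
  rewrite !card_eq_le => /andP[_ SB] /andP[AS _].
  apply: card_le_trans AS _; apply: card_le_trans SB _; apply: subset_card_le.
  by move=> _ [f Sf <-]; exact: S_choice Sf PB.
have noA_ex A : P A -> exists x, A x /\ forall f, S f -> f A <> x.
  move=> PA; apply: contrapT => nx; apply: noA; exists A => // x Ax.
  apply: contrapT => Sx; apply: nx; exists x; split=> // f Sf fx.
  by apply: Sx; exists f.
(* [x0] is only a default value for [g] on sets outside [P], where nothing is required. *)
have [x0 _] := noA_ex _ PA0.
have /choice[g gP] A : exists x, P A -> A x /\ forall f, S f -> f A <> x.
  have [/noA_ex[x Ax]|nPA] := pselect (P A); last by exists x0.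
  by exists x.
(* Adding [g] contradicts maximality: on every member of [P] it avoids all values taken by [S], so
   it is not in [S], as its value at [A0] shows. *)
case: (S_max (S `|` [set g])).
  split=> [f Sf|gS]; first by left.
  by have [_ /(_ g (gS _ (or_intror erefl)))] := gP _ PA0; apply.
split=> [f A [Sf|->] PA|f f' A [Sf|->] [Sf'|->] // PA fA].
- exact: S_choice Sf PA.
- by have [] := gP _ PA.
- exact: S_inj fA.
- by have [_ /(_ _ Sf)] := gP _ PA.
- by have [_ /(_ _ Sf')] := gP _ PA; rewrite fA.
Qed.

Lemma card_le_setC1 (T : Type) (x : T) :
  infinite_set [set: T] -> ([set: T] #<= ~` [set x])%card.
Proof.
move=> Tinf.
have /infiniteP/card_leP[f] : infinite_set (~` [set x]).
  by rewrite -setTD; apply: infinite_setD => //; exact: finite_set1.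
pose e n : T := set_val (f (exist _ n (in_setT n))).
(* The shift along the sequence x, e 0, e 1, ... misses exactly x. *)
pose s n := if n is m.+1 then e m else x.
have e_inj : injective e.
  by move=> m n /val_inj /(@inj _ _ _ f _ _ (in_setT _) (in_setT _)) [].
have eNx n : e n <> x by exact: set_valP (f _).
have s_inj : injective s.
  by move=> [|m] [|n] //= => [/esym/eNx|/eNx|/e_inj->].
(* A moved point lands on some [e n], hence not on [x]; a fixed point lies off the sequence, hence
   is not [x], which is [s 0]. *)
pose shift y := if pselect (exists n, s n = y) is left sy
  then s (projT1 (cid sy)).+1 else y.
have shift_inj : injective shift.
  move=> y z; rewrite /shift.
  case: pselect => [sy|nsy]; case: pselect => [sz|nsz] //.
  - by case: cid => m /= <-; case: cid => n /= <- /e_inj ->.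
  - by case: cid => m /= _ em; case: nsz; exists m.+1.
  - by case: cid => n /= _ en; case: nsy; exists n.+1.
have := inj_card_eq (in2W shift_inj : {in setT &, injective shift}).
rewrite card_eq_le => /andP[_ Ts].
apply: card_le_trans Ts _; apply: subset_card_le => _ [y _ <-] /=.
rewrite /shift; case: pselect => [sy|nsy yx]; first exact: eNx.
by apply: nsy; exists 0; rewrite yx.
Qed.

Local Open Scope ring_scope.

Lemma dense_mdistP (R : realType) (X : metricType R) (A : set X) :
  dense A <-> forall x e, 0 < e -> exists2 a, A a & mdist x a < e.
Proof.
split=> [dA x e e0|dA O [x Ox] oO].
  (* Density concerns open sets, hence the interior of the ball, which still contains [x]. *)
  have [||a [/=]] := dA (interior (ball x e)).
  - by exists x; exact: nbhsx_ballx.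
  - exact: open_interior.
  - by move=> /interior_subset; rewrite ballEmdist/= => xa Aa; exists a.
have /nbhs_ballP[e /= e0 eO] : nbhs x O by exact: open_nbhs_nbhs.
have [a Aa xa] := dA x e e0.
by exists a; split=> //; apply: eO; rewrite ballEmdist.
Qed.

(** If [x] and [y] differ, a point of [A] closer to [x] than half their distance cannot be
    equidistant from both, by the triangle inequality. *)
Lemma dense_resolving (R : realType) (X : metricType R) (A : set X) :
  dense A -> resolving A.
Proof.
move=> /dense_mdistP dA x y xy; apply: contrapT => /eqP nxy.
have d0 : 0 < mdist x y / 2 by rewrite divr_gt0// mdist_gt0.
have [a Aa xa] := dA x _ d0.
have := metric_triangle x a y; rewrite leNgt => /negP; apply.
by rewrite (metric_sym a) -xy// [ltRHS]splitr ltrD.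
Qed.

Section resolving_valued.
Context (R : realType) (F : fieldType) (v : absolute_value R F).

Lemma absval1 : v 1 = 1.
Proof.
have v1N0 : v 1 != 0 by apply/eqP => /absval_eq0/eqP; rewrite oner_eq0.
by apply: (mulfI v1N0); rewrite -absvalM !mulr1.
Qed.

Lemma absval_gt0 x : (0 < v x) = (x != 0).
Proof.
rewrite lt_def absval_ge0 andbT; congr (~~ _).
by apply/eqP/eqP; case: (absval_eq0 v x).
Qed.

Lemma absvalX x n : v (x ^+ n) = v x ^+ n.
Proof. by elim: n => [|n IH]; rewrite ?expr0 ?absval1// !exprS absvalM IH. Qed.

Lemma absvalV x : v x^-1 = (v x)^-1.
Proof.
have [->|x0] := eqVneq x 0.
  by rewrite invr0 (proj2 (absval_eq0 v 0) erefl) invr0.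
have vx0 : v x != 0 by rewrite gt_eqF// absval_gt0.
by apply: (mulfI vx0); rewrite -absvalM !mulfV// absval1.
Qed.

Lemma nontrivial_absval_lt1 : ~ trivial_absval v -> exists2 t, t != 0 & v t < 1.
Proof.
move=> vN; apply: contrapT => noT; apply: vN.
(* This bound, applied to both [x] and its inverse, forces [v x = 1]. *)
have v_ge1 t : t != 0 -> 1 <= v t.
  by move=> t0; rewrite leNgt; apply/negP => vt; apply: noT; exists t.
split=> [|x /eqP x0]; first exact/absval_eq0.
apply/eqP; rewrite eq_le v_ge1// andbT -invf_ge1 ?absval_gt0//.
by rewrite -absvalV v_ge1// invr_eq0.
Qed.

(** Powers of an element of absolute value below 1 tend to 0. *)
Lemma nontrivial_absval_small e : ~ trivial_absval v -> 0 < e ->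
  exists2 t, t != 0 & v t < e.
Proof.
move=> /nontrivial_absval_lt1[t t0 vt1] e0.
have vt : `|v t| < 1 by rewrite ger0_norm ?absval_ge0.
have /cvgrPdist_lt vt_cvg := cvg_expr vt.
have [n _ /(_ n (leqnn n))] := vt_cvg e e0.
rewrite sub0r normrN ger0_norm ?exprn_ge0 ?absval_ge0// => vtn.
by exists (t ^+ n); rewrite ?expf_neq0// absvalX.
Qed.

Lemma nonarchimedean_resolving_dense (A : set (valued v)) :
  ~ trivial_absval v -> nonarchimedean v -> resolving A -> dense A.
Proof.
move=> vN vna rA; apply/dense_mdistP => x e e0.
have [t t0 vte] := nontrivial_absval_small e vN e0.
pose y : valued v := (x : F) + t.
have yx : mdist x y = v t.
  by rewrite metric_sym mdist_valuedE /y addrC addKr.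
have [a Aa xya] : exists2 a, A a & mdist x a <> mdist y a.
  apply: contrapT => noa.
  have xy : x = y.
    by apply: rA => a Aa; apply: contrapT => xya; apply: noa; exists a.
  by move: yx; rewrite -xy mdistxx => /esym/absval_eq0/eqP; rewrite (negPf t0).
(* If [x] were closer to [y] than to [a], the triangle [x], [y], [a] would be isosceles with apex
   [a], so [a] would not separate [x] from [y]. *)
exists a => //; apply: le_lt_trans vte; rewrite -yx leNgt; apply/negP => yxa.
have ultra (z w : valued v) : mdist z a <= Num.max (mdist z w) (mdist w a).
  rewrite !mdist_valuedE; have := vna ((z : F) - w) ((w : F) - a).
  by rewrite subrKA.
apply: xya; apply: le_anti; apply/andP; split.
  have := ultra x y; rewrite metric_sym le_max => /orP[|//].
  by rewrite leNgt metric_sym yxa.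
by apply: le_trans (ultra y x) _; rewrite ge_max lexx andbT metric_sym ltW.
Qed.

(** All points outside [A] are at distance 1 from every point of [A], so [A] cannot separate two of
    them. *)
Lemma trivial_resolving_omits_one (A : set (valued v)) :
  trivial_absval v -> resolving A -> exists x, ~` [set x] `<=` A.
Proof.
move=> [_ v1] rA.
have [[x nAx]|noA] := pselect (exists x, ~ A x); last first.
  by exists (0 : F) => y _; apply: contrapT => nAy; apply: noA; exists y.
exists x => y; apply: contra_notP => nAy /=; apply: rA => a Aa.
have d1 z : ~ A z -> mdist z a = 1.
  move=> nAz; rewrite mdist_valuedE v1// => /eqP; rewrite subr_eq0 => /eqP za.
  by apply: nAz; rewrite za.
by rewrite !d1.
Qed.

(** The open ball of radius 1 around a point is reduced to that point. *)
Lemma trivial_dense_setT (A : set (valued v)) :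
  trivial_absval v -> dense A -> A = setT.
Proof.
move=> [_ v1] /dense_mdistP dA; rewrite -subTset => x _.
have [a Aa] := dA x 1 ltr01.
have [->//|/eqP xa] := eqVneq x a.
rewrite mdist_valuedE v1 ?ltxx// => /eqP.
by rewrite subr_eq0 => /eqP.
Qed.

End resolving_valued.

Theorem theorem2p6 (R : realType) (F : fieldType) (v : absolute_value R F)
    (F_infinite : infinite_set [set: F]) :
  (~ trivial_absval v -> nonarchimedean v ->
     exists K : set F, metric_dimension (valued v) K /\
                       density_character (valued v) K) /\
  (trivial_absval v ->
     metric_dimension (valued v) [set: F] /\
     density_character (valued v) [set: F]).
Proof.
have denseT : dense [set: valued v].
  by move=> O O0 _; rewrite setIT.
split=> [vN vna|v1].
  (* A dense set of least cardinality represents both invariants, as dense and resolving sets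
     coincide here. *)
  have [|K dK Kmin] := @ex_card_min (valued v) (@dense (valued v)).
    by exists setT.
  exists K; split; split.
  - by exists K; [exact: dense_resolving|exact: card_eqxx].
  - move=> A rA; apply: Kmin; exact: nonarchimedean_resolving_dense.
  - by exists K => //; exact: card_eqxx.
  - exact: Kmin.
split; split.
- by exists setT; [exact: dense_resolving|exact: card_eqxx].
- move=> A /(trivial_resolving_omits_one _ _ _ _ v1)[x xA].
  (* Removing one point from an infinite field does not lower its cardinality. *)
  exact: card_le_trans (card_le_setC1 _ x F_infinite) (subset_card_le xA).
- by exists setT => //; exact: card_eqxx.
- by move=> A /(trivial_dense_setT _ _ _ _ v1)->; exact: card_lexx.
Qed.
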